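(* Let $\nu$ be a probability measure on $\mathbb{R}$ with continuous density $\lambda$. For $\alpha\in\mathbb{R}$ let $\nu_\alpha$ be the translate of $\nu$ by $\alpha$, i.e. the probability measure with density $\lambda_\alpha(x)=\lambda(x-\alpha)$. Assume that $\lambda$ is bounded and that $\lambda(z)>0$ on $(\kappa_L,\kappa_R)$, the interior of the support of $\nu$ (where $-\infty\le\kappa_L<\kappa_R\le\infty$). Let $A$ be a monotone increasing subset of $\mathbb{R}^n$. Then the function $\alpha\mapsto\nu_\alpha^{\otimes n}(A)$ is differentiable, and its derivative is given by $$\frac{d\,\nu_\alpha^{\otimes n}(A)}{d\alpha}=\sum_{i=1}^n I_i^{\mathcal G}(A),$$ where the geometric influences are taken with respect to the measure $\nu_\alpha^{\otimes n}$.
   Context: A set $A\subseteq\mathbb{R}^n$ is monotone increasing if $x\in A$ and $y_j\ge x_j$ for all $j$ imply $y\in A$. Geometric influence: for a probability measure $\eta$ on $\mathbb{R}$ and a measurable $S\subseteq\mathbb{R}$, the lower Minkowski content is $\eta^+(S)=\liminf_{r\downarrow 0}\frac{\eta(S+[-r,r])-\eta(S)}{r}$ (Minkowski sum). For $A\subseteq\mathbb{R}^n$, $x\in\mathbb{R}^n$ and $1\le i\le n$, let $A_i^x=\{y\in\mathbb{R}:(x_1,\dots,x_{i-1},y,x_{i+1},\dots,x_n)\in A\}$. The geometric influence of the $i$th coordinate on $A$ with respect to $\eta^{\otimes n}$ is $I_i^{\mathcal G}(A)=\mathbb{E}_{x\sim\eta^{\otimes n}}[\eta^+(A_i^x)]$.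 *)

(* Defs.v *)
From HB Require Import structures.
From mathcomp Require Import all_boot all_order all_algebra.
From mathcomp Require Import all_classical all_reals all_analysis.
From mathcomp Require Import measurable_realfun.

Set Implicit Arguments.
Unset Strict Implicit.
Unset Printing Implicit Defensive.

Import Order.TTheory GRing.Theory Num.Theory.
Import numFieldNormedType.Exports.

Local Open Scope classical_set_scope.
Local Open Scope ring_scope.
Local Open Scope ereal_scope.

Section monotone_sets.
Context {R : realType} {n : nat}.

Definition monotone_increasing (A : set (n.-tuple R)) : Prop :=
  forall x y : n.-tuple R,
    A x -> (forall j, (tnth x j <= tnth y j)%R) -> A y.

Definition fiber (A : set (n.-tuple R)) (i : 'I_n) (x : n.-tuple R) : set R :=
  [set y | A [tuple if j == i then y else tnth x j | j < n]].

End monotone_sets.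

Section measures_on_the_line.
Context {R : realType}.

Definition measure_support (mu : set R -> \bar R) : set R :=
  [set x | forall U : set R, open U -> U x -> 0 < mu U].

Definition has_density (mu : set R -> \bar R) (f : R -> R) : Prop :=
  [/\ measurable_fun setT f, forall x, (0 <= f x)%R &
    forall B : set R, measurable B ->
      mu B = \int[lebesgue_measure]_(x in B) (f x)%:E].

Definition shift_by (a : R) : R -> R := fun x => (x + a)%R.

Lemma measurable_shift_by (a : R) : measurable_fun setT (shift_by a).
Proof. exact: measurable_funD. Qed.

HB.instance Definition _ (a : R) :=
  isMeasurableFun.Build _ _ _ _ (shift_by a) (measurable_shift_by a).

Definition translate (nu : probability R R) (a : R) : probability R R :=
  distribution nu (shift_by a).

Lemma lebesgue_measure_shift (a : R) (B : set R) : measurable B ->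
  pushforward lebesgue_measure (shift_by a : _ -> measurableTypeR R) B =
  lebesgue_measure B.
Proof.
have ms : measurable_fun setT (shift_by a : _ -> measurableTypeR R).
  exact: measurable_shift_by.
move=> mB; apply/esym.
apply: lebesgue_measure_unique => // _ [[b c] _ <-].
rewrite /= /pushforward (_ : _ @^-1` _ = [set` `]b - a, c - a]%R]).
  rewrite !lebesgue_measure_itv/= !lte_fin ltrD2r; case: ifP => // _.
  by rewrite -!EFinD opprB addrA subrK.
by apply/seteqP; split=> x /=; rewrite /shift_by !in_itv/= ltrBlDr lerBrDr.
Qed.

Lemma translate_density (nu : probability R R) (f : R -> R) (a : R) :
  has_density nu f -> has_density (translate nu a) (fun x => f (x - a)%R).
Proof.
move=> [mf f0 nuf].
have mfa : measurable_fun setT (fun x : R => f (x - a)%R).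
  by apply: (measurableT_comp mf); exact: measurable_shift_by.
split=> // B mB.
have mB' : measurable (shift_by a @^-1` B).
  by rewrite -[X in measurable X]setTI; exact: measurable_shift_by.
transitivity (nu (shift_by a @^-1` B)) => //; rewrite nuf//.
have ms : measurable_fun setT
    (shift_by a : measurableTypeR R -> measurableTypeR R).
  exact: measurable_shift_by.
under eq_integral => x _ do rewrite -[x in f x](addrK a).
rewrite -[LHS](ge0_integral_pushforward ms lebesgue_measure mB
  (f := fun x => (f (x - a)%R)%:E)).
- by apply: eq_measure_integral => C mC _; exact: lebesgue_measure_shift.
- by apply/measurable_EFinP; apply: measurable_funS mfa.
- by move=> x _; rewrite lee_fin.
Qed.

Definition minkowski_sum (S T : set R) : set R :=
  [set (s + t)%R | s in S & t in T].

Definition lower_minkowski_content (eta : set R -> \bar R) (S : set R) :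
    \bar R :=
  limf_einf (fun r : R =>
    (eta (minkowski_sum S `[(- r)%R, r]) - eta S) * (r^-1)%:E) 0^'+.

End measures_on_the_line.

Section power_of_a_probability.
Context {d} {T : measurableType d} {R : realType}.

Definition cons_pair n (x : T * n.-tuple T) : n.+1.-tuple T :=
  [tuple of x.1 :: x.2].

Lemma measurable_cons_pair n : measurable_fun setT (@cons_pair n).
Proof. exact: measurable_cons. Qed.

HB.instance Definition _ n :=
  isMeasurableFun.Build _ _ _ _ (@cons_pair n) (@measurable_cons_pair n).

Fixpoint power_probability (P : probability T R) n :
    probability (n.-tuple T) R :=
  if n is m.+1 then
    distribution (P \x power_probability P m) (@cons_pair m)
  else \d_ [tuple].

Lemma power_probability_box (P : probability T R) n (B : 'I_n -> set T) :
  (forall i, measurable (B i)) ->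
  power_probability P n [set x | forall i, B i (tnth x i)] =
  \prod_(i < n) P (B i).
Proof.
elim: n B => [|n IH] B mB /=.
  rewrite big_ord0 diracE mem_set//= => -[].
  by [].
rewrite big_ord_recl -(IH (fun i => B (lift ord0 i))) => [|i]; last exact: mB.
rewrite -product_measure1E//; last first.
  rewrite (_ : mkset _ =
      \bigcap_(i in [set: 'I_n]) (@tnth n T ^~ i @^-1` B (lift ord0 i))).
    apply: fin_bigcap_measurable => // i _.
    by rewrite -[X in measurable X]setTI; exact: measurable_tnth.
  by apply/seteqP; split=> x /= Bx i => [_|]; exact: Bx.
rewrite /distribution /pushforward; congr (_ _); apply/seteqP; split.
  move=> -[x y] /= Bxy; split=> [|i]; first exact: (Bxy ord0).
  by have := Bxy (lift ord0 i); rewrite /cons_pair tnthS.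
move=> -[x y] /= [Bx By] i; case: (unliftP ord0 i) => [j ->|->//].
by rewrite /cons_pair tnthS; exact: By.
Qed.

(* Monotone subsets of R^n need not be Borel, so the product measure is
   completed.  The completion lives on the Caratheodory sigma-algebra of the
   outer measure induced by the product measure. *)
Definition completed_power (P : probability T R) n :=
  @completed_measure_extension _ _ _ (power_probability P n).
Arguments completed_power P n : clear implicits.

HB.instance Definition _ (P : probability T R) n :=
  Measure.on (completed_power P n).

End power_of_a_probability.
Arguments completed_power {d T R} P n.

Definition geometric_influence {R : realType} (eta : probability R R) n
    (A : set (n.-tuple R)) (i : 'I_n) : \bar R :=
  \int[completed_power eta n]_x lower_minkowski_content eta (fiber A i x).

(* Main.v *)
(* Write nu_b for the translate of nu by b.  On the line, an increasing set S
   with boundary point t has nu_b(S) = nu[t - b, +oo), and its r-enlargement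
   has the nu_b-measure of S under nu_(b+r); so b |-> nu_b(S) is
   M-Lipschitz, M bounding the density, and its derivative is the lower
   Minkowski content of S.

   For Borel increasing B in R^(n+1), induct on n.  Write F_B(b) for the
   nu_b^(n+1)-measure of B, B_y for the section at first coordinate y and B^x
   for the section at the remaining coordinates x.  Then
     F_B(a+h) - F_B(a) = int (F_(B_y)(a+h) - F_(B_y)(a)) d nu_(a+h)(y)
                         + int (nu_(a+h) - nu_a)(B^x) d nu_a^n(x).
   Dividing by h, the integrand of the first term is bounded (F_(B_y) is
   nM-Lipschitz) and converges by induction; replacing d nu_(a+h) by d nu_a is
   harmless because the densities converge in L^1 (Scheffe).  The second term
   is dominated convergence and the one-dimensional case.

   A general increasing A lies between a Borel increasing set B made of
   orthants with rational vertices and the Borel set C of the x with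
   x + (1/k, ..., 1/k) in B for all k >= 1.  Translation gives
   F_C(a) <= F_B(a + 1/k), hence F_C = F_B by continuity.  Therefore the fibers
   of B, A and C have the same measure almost everywhere, and then the same
   content: if S is contained in S' and nu_a(S) = nu_a(S'), then
   b |-> nu_b(S') - nu_b(S) has a minimum at a, so its derivative is 0 there. *)
From HB Require Import structures.
Require Import Defs.
From mathcomp Require Import all_boot all_order all_algebra.
From mathcomp Require Import all_classical all_reals all_analysis.
From mathcomp Require Import measurable_realfun lra.
Import Order.TTheory GRing.Theory Num.Theory.
Import numFieldNormedType.Exports.
Local Open Scope classical_set_scope.
Local Open Scope ring_scope.

Set Implicit Arguments.
Unset Strict Implicit.
Unset Printing Implicit Defensive.

(** * Densities and convergence of integrals *)

(** Every member of the filter meets the set where [f x <= l + e], which bounds all the infima by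
    [l + e]. The set where [l - e <= f x] is itself a member, and its infimum is at least
    [l - e]. *)
Lemma cvg_limf_einf (T : choiceType) (X : filteredType T) (R : realType)
    (f : X -> \bar R) (F : set_system X) (l : R) : ProperFilter F ->
  f x @[x --> F] --> l%:E -> limf_einf f F = l%:E.
Proof.
move=> PF fl; rewrite limf_einfE; apply/eqP; rewrite eq_le; apply/andP; split.
- apply: ge_ereal_sup => _ [V FV <-]; apply/lee_addgt0Pr => e e0.
  have /= Fl : \forall x \near F, (f x <= l%:E + e%:E)%E.
    have [fin /cvgrPdist_le/(_ e e0) le] := (fine_cvgP _ _).1 fl.
    near=> x.
    have fx : f x \is a fin_num by near: x.
    rewrite -(fineK fx) -EFinD lee_fin -lerBlDl.
    by rewrite (le_trans (ler_norm _))// distrC; near: x.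
  have [x [Vx xl]] := filter_ex (filterI FV Fl).
  by apply: le_trans xl; apply: ereal_inf_lbound; exists x.
- apply/lee_subgt0Pr => e e0.
  have /= Fl : \forall x \near F, (l%:E - e%:E <= f x)%E.
    have [fin /cvgrPdist_le/(_ e e0) le] := (fine_cvgP _ _).1 fl.
    near=> x.
    have fx : f x \is a fin_num by near: x.
    rewrite -(fineK fx) -EFinB lee_fin lerBlDr -lerBlDl.
    by rewrite (le_trans (ler_norm _))//; near: x.
  apply: le_trans (ereal_sup_ubound _); last by eexists; [exact: Fl|].
  by apply: le_ereal_inf_tmp => _ [x /= + <-].
Unshelve. all: by end_near. Qed.


Section density.
Context {d} {T : measurableType d} {R : realType} (P : probability T R).
Context (mu : {sigma_finite_measure set T -> \bar R}) (f : T -> R).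
Hypotheses (mf : measurable_fun setT f) (f0 : forall x, 0 <= f x).
Hypothesis PE : forall B, measurable B -> P B = (\int[mu]_(x in B) (f x)%:E)%E.

Lemma density_dominated : P `<< mu.
Proof.
apply/null_content_dominatesP => A mA A0.
rewrite PE// null_set_integral//.
by apply/measurable_EFinP; exact: measurable_funTS.
Qed.

(** Both [f] and the Radon-Nikodym derivative of [P] have integral [P E] over every measurable [E],
    so they agree almost everywhere. *)
Lemma integral_density (g : T -> \bar R) : P.-integrable setT g ->
  (\int[P]_x g x = \int[mu]_x (g x * (f x)%:E))%E.
Proof.
move=> ig; have mg := measurable_int _ ig.
rewrite -(Radon_Nikodym_change_of_variables density_dominated)//=.
apply: ae_eq_integral => //.
- apply: emeasurable_funM => //; apply: (measurable_int mu).
  by apply: Radon_Nikodym_integrable; exact: density_dominated.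
- by apply: emeasurable_funM => //; exact/measurable_EFinP.
- apply: ae_eqe_mul2l => /=.
  rewrite Radon_NikodymE//=; first exact: density_dominated.
  move=> Pmu; case: cid => /= h [h1 h2 h3].
  apply: integral_ae_eq => //=; first exact/measurable_EFinP.
  by move=> E _ mE; rewrite -h3//= PE.
Qed.

End density.

Lemma integral_has_density {R : realType} (P : probability R R) (f : R -> R)
    (g : R -> \bar R) : has_density P f -> P.-integrable setT g ->
  (\int[P]_x g x = \int[lebesgue_measure]_x (g x * (f x)%:E))%E.
Proof.
move=> [mf f0 PE] ig; have mg := measurable_int _ ig.
(* R and measurableTypeR R are distinct measurable types with the same sets;
   the Lebesgue measure lives on the latter, P on the former. *)
pose idR : R -> measurableTypeR R := idfun.
have mid : measurable_fun setT idR by exact: (@measurable_id _ (measurableTypeR R) setT).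
pose idM : {mfun R >-> measurableTypeR R} :=
  HB.pack idR (isMeasurableFun.Build _ _ _ _ idR mid).
transitivity (\int[distribution P idM]_x g x)%E.
  by rewrite integral_pushforward.
apply: integral_density => //.
apply: integrable_pushforward => //.
Qed.

Lemma has_density_integrable {R : realType} (P : probability R R) (f : R -> R) :
  has_density P f -> lebesgue_measure.-integrable setT (EFin \o f).
Proof.
move=> [mf f0 PE]; apply/integrableP; split; first exact/measurable_EFinP.
under eq_integral => x _ do rewrite /= ger0_norm//.
by rewrite -PE//; apply: le_lt_trans (ltry 1); exact: probability_le1.
Qed.

Lemma bounded_integrable d (T : measurableType d) (R : realType) (P : probability T R)
    (q : T -> R) K : measurable_fun setT q -> (forall x, `|q x| <= K) ->
  P.-integrable setT (EFin \o q).
Proof.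
move=> mq qK; have := finite_measure_integrable_cst P K measurableT.
apply: le_integrable => //; first exact/measurable_EFinP.
by move=> x _; rewrite /= lee_fin (le_trans (qK x))// ler_norm.
Qed.

Lemma fine_probability_le1 d (T : measurableType d) (R : realType)
    (P : probability T R) (A : set T) : measurable A -> `|fine (P A)| <= 1.
Proof.
move=> mA; rewrite ger0_norm ?fine_ge0// -lee_fin fineK ?fin_num_measure//.
exact: probability_le1.
Qed.

Lemma bounded_Rintegral d (T : measurableType d) (R : realType)
    (P : probability T R) (q : T -> R) K :
  measurable_fun setT q -> (forall x, `|q x| <= K) -> `|\int[P]_x q x| <= K.
Proof.
move=> mq qK; have iq := @bounded_integrable _ _ _ P _ _ mq qK.
apply: le_trans (le_normr_Rintegral _ _) _ => //.
rewrite -[leRHS]mulr1 -[X in K * X](_ : fine (P setT) = 1); last first.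
  by rewrite probability_setT.
rewrite -Rintegral_cst//; apply: le_Rintegral => //.
- by have := integrable_abse iq.
- exact: finite_measure_integrable_cst.
Qed.

Section bounded_convergence.
Context d (T : measurableType d) (R : realType) (P : probability T R).

Lemma bounded_convergence (q : nat -> T -> R) (g : T -> R) K :
  (forall k, measurable_fun setT (q k)) -> (forall k x, `|q k x| <= K) ->
  (forall x, q k x @[k --> \oo] --> g x) ->
  \int[P]_x q k x @[k --> \oo] --> \int[P]_x g x.
Proof.
move=> mq qK qg.
have mg : measurable_fun setT g by apply: measurable_fun_cvg => // x _; exact: qg.
have gK x : `|g x| <= K.
  have nqg : `|q k x| @[k --> \oo] --> `|g x| by apply: cvg_norm; exact: qg.
  rewrite -(cvg_lim _ nqg)//; apply: limr_le; last exact: nearW.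
  by apply/cvg_ex; eexists; exact: nqg.
have [|||||ig _ H] := @dominated_convergence _ _ _ P setT measurableT
    (fun k => EFin \o q k) (EFin \o g) (EFin \o cst K).
- by move=> k; exact/measurable_EFinP.
- exact/measurable_EFinP.
- by apply: aeW => x _; apply: cvg_EFin; [exact: nearW|exact: qg].
- exact: finite_measure_integrable_cst.
- by apply: aeW => x k _ /=; rewrite lee_fin.
rewrite /Rintegral; apply: fine_cvg.
by rewrite fineK//; exact: integrable_fin_num ig.
Qed.

End bounded_convergence.

(** Scheffe's lemma. Since [|u - v| = u + v - 2 min(u, v)] and the total masses agree, it suffices
    that the integral of [min(f_ k, f)] tends to that of [f]. This is dominated convergence with
    dominating function [f]. *)
Lemma scheffe d (T : measurableType d) (R : realType)
    (mu : {measure set T -> \bar R}) (f_ : nat -> T -> R) (f : T -> R) :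
  (forall k, mu.-integrable setT (EFin \o f_ k)) ->
  mu.-integrable setT (EFin \o f) ->
  (forall k x, 0 <= f_ k x) -> (forall x, 0 <= f x) ->
  (forall k, \int[mu]_x f_ k x = \int[mu]_x f x) ->
  (forall x, f_ k x @[k --> \oo] --> f x) ->
  \int[mu]_x `|f_ k x - f x| @[k --> \oo] --> 0.
Proof.
move=> if_ if0 f_0 f0 intE f_f.
have mf : measurable_fun setT f by apply/measurable_EFinP; exact: measurable_int if0.
have mf_ k : measurable_fun setT (f_ k).
  by apply/measurable_EFinP; exact: measurable_int (if_ k).
pose m k x := Num.min (f_ k x) (f x).
have mm k : measurable_fun setT (m k) by exact: measurable_minr.
have m0 k x : 0 <= m k x by rewrite le_min f_0 f0.
have mlef k x : m k x <= f x by rewrite ge_min lexx orbT.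
have im k : mu.-integrable setT (EFin \o m k).
  apply: le_integrable if0 => //; first exact/measurable_EFinP.
  by move=> x _ /=; rewrite lee_fin !ger0_norm.
have m_f x : m k x @[k --> \oo] --> f x.
  apply/cvgrPdist_le => e e0; have /cvgrPdist_le/(_ e e0) := f_f x.
  apply: filterS => k; rewrite /m; case: (leP (f_ k x) (f x)) => // _ _.
  by rewrite subrr normr0 ltW.
have int_m : \int[mu]_x m k x @[k --> \oo] --> \int[mu]_x f x.
  have [|||||_ _ H] := @dominated_convergence _ _ _ mu setT measurableT
      (fun k => EFin \o m k) (EFin \o f) (EFin \o f).
  - by move=> k; exact/measurable_EFinP.
  - exact/measurable_EFinP.
  - by apply: aeW => x _; apply: cvg_EFin; [exact: nearW|exact: m_f].
  - exact: if0.
  - by apply: aeW => x k _ /=; rewrite lee_fin ger0_norm.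
  rewrite /Rintegral; apply: fine_cvg.
  by rewrite fineK//; exact: integrable_fin_num if0.
have -> : (fun k => \int[mu]_x `|f_ k x - f x|) =
    (fun k => 2 * \int[mu]_x f x - 2 * \int[mu]_x m k x).
  apply/funext => k.
  transitivity (\int[mu]_x ((f_ k x + f x) - 2 * m k x)).
    apply: eq_Rintegral => x _; rewrite /m.
    by case: (leP (f_ k x) (f x)) => h; [rewrite ler0_norm|rewrite gtr0_norm]; lra.
  rewrite RintegralB//; last 2 first.
  - by have := integrableD measurableT (if_ k) if0.
  - by have := integrableZl measurableT 2 (im k).
  rewrite RintegralD// RintegralZl// intE; lra.
rewrite -[X in _ --> X](subrr (2 * \int[mu]_x f x)).
by apply: cvgB; [exact: cvg_cst|apply: cvgMl_tmp; exact: int_m].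
Qed.

(** * Translates of a measure on the line *)

Definition up_closed {R : realType} (S : set R) :=
  forall x y, S x -> x <= y -> S y.

Section up_closed_sets.
Context {R : realType}.
Implicit Type S : set R.

Lemma up_closed_measurable S : up_closed S -> measurable S.
Proof.
move=> uS; apply: is_interval_measurable => x y Sx Sy z /andP[xz _].
exact: uS xz.
Qed.

Lemma up_closed_cases S : up_closed S ->
  [\/ S = set0, S = setT |
    exists t, `]t, +oo[%classic `<=` S /\ S `<=` `[t, +oo[%classic].
Proof.
move=> uS.
have [->|/set0P[x Sx]] := eqVneq S set0; first by constructor 1.
have [->|/eqP ST] := eqVneq S setT; first by constructor 2.
constructor 3.
have [y nSy] : exists y, ~ S y.
  by apply/existsNP => h; apply: ST; rewrite -subTset => z _; exact: h.
have lbS : has_lbound S.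
  by exists y => z Sz; rewrite leNgt; apply/negP => /ltW /(uS _ _ Sz).
(* The infimum is a real number because [S] is neither empty nor the whole line. Whether it belongs
   to [S] is left open. *)
exists (inf S); split => z /=; rewrite in_itv/= andbT.
  have S0 : S !=set0 by exists x.
  by move=> /(inf_lt S0)[u Su /ltW]; exact: uS.
by move=> Sz; apply: ge_inf.
Qed.

Lemma up_closed_shift S a : up_closed S -> up_closed (shift_by a @^-1` S).
Proof. by move=> uS x y Sx xy; apply: uS Sx _; rewrite lerD2r. Qed.

End up_closed_sets.

Definition upper_tail {R : realType} (nu : set R -> \bar R) (s : R) :=
  fine (nu `[s, +oo[%classic).

Section tail.
Context {R : realType} (nu : probability R R) (f : R -> R).
Hypothesis nuf : has_density nu f.
Hypothesis cf : continuous f.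

Local Notation tail := (upper_tail nu).

Lemma density_set1 t : nu [set t] = 0%E.
Proof. by case: nuf => _ _ ->//; rewrite integral_set1. Qed.

(** The common source of the Lipschitz bound, with [c = 0] and [C = M], and of the derivative, with
    [c] and [C] equal to [f t - e] and [f t + e]. *)
Lemma tail_sub s t c C : s <= t -> (forall x, s <= x <= t -> c <= f x <= C) ->
  c * (t - s) <= tail s - tail t <= C * (t - s).
Proof.
move=> st cfC; have [mf f0 nuE] := nuf.
have -> : tail s - tail t = fine (nu `[s, t]%classic).
  rewrite /upper_tail (@itv_bndbnd_setU _ _ (BLeft s) (BLeft t) +oo%O)//.
  rewrite measureU//; last first.
    apply/seteqP; split=> x //= [] /=; rewrite !in_itv/= andbT => /andP[_ xt] tx.
    by move: (lt_le_trans xt tx); rewrite ltxx.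
  rewrite fineD ?fin_num_measure// addrK.
  rewrite -(setUitv1 true (a := BLeft s))// measureU//.
    by rewrite [X in (_ + X)%E](density_set1 t) adde0.
  apply/seteqP; split=> x //= [] /=; rewrite in_itv/= => /andP[_ +] xt.
  by rewrite xt ltxx.
have lst : (lebesgue_measure (`[s, t]%classic : set R) = (t - s)%:E :> \bar R)%E.
  rewrite lebesgue_measure_itv/= lte_fin; case: ltP => //.
  by move=> ts; have -> : s = t by [apply/eqP; rewrite eq_le st ts]; rewrite subrr.
have icst k : lebesgue_measure.-integrable `[s, t]%classic (EFin \o cst k : R -> \bar R).
  apply: (@continuous_compact_integrable R (cst k)).
    exact: segment_compact.
  exact: continuous_subspaceT (@cst_continuous _ _ k).
have ifs : lebesgue_measure.-integrable `[s, t]%classic (EFin \o f).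
  by apply: integrableS (has_density_integrable nuf).
have nust : nu `[s, t]%classic = (fine (nu `[s, t]%classic))%:E.
  by rewrite fineK// fin_num_measure.
rewrite -!lee_fin -nust nuE// !EFinM -lst -!integral_cst//.
apply/andP; split; apply: le_integral => //; first exact: icst.
- by move=> x; rewrite inE/= in_itv/= lee_fin => /cfC/andP[].
- exact: icst.
- by move=> x; rewrite inE/= in_itv/= lee_fin => /cfC/andP[].
Qed.

Lemma tail_lipschitz M : (forall x, `|f x| <= M) ->
  forall s t, `|tail s - tail t| <= M * `|s - t|.
Proof.
move=> fM.
have H s t : s <= t -> `|tail s - tail t| <= M * `|s - t|.
  move=> st; have [_ f0 _] := nuf.
  have /andP[h1 h2] : 0 * (t - s) <= tail s - tail t <= M * (t - s).
    apply: tail_sub => // x _; rewrite f0/=.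
    by rewrite (le_trans (ler_norm _)).
  rewrite mul0r in h1; rewrite ger0_norm// (le_trans h2)//.
  by rewrite distrC ger0_norm// subr_ge0.
move=> s t; have [st|/ltW ts] := leP s t; first exact: H.
by rewrite distrC (distrC s) H.
Qed.

Lemma tail_derive t : (tail (t - h) - tail t) / h @[h --> 0^'] --> f t.
Proof.
apply/cvgrPdist_le => e e0.
have /cvgrPdist_le/(_ e e0)[d /= d0 fd] : f x @[x --> t] --> f t by exact: cf.
exists d => //= h; rewrite /ball_/= sub0r normrN => hd h0.
have near_f x : `|x - t| <= `|h| -> f t - e <= f x <= f t + e.
  move=> xt; have := fd x; rewrite /ball_/= distrC => /(_ (le_lt_trans xt hd)).
  by rewrite ler_distlC.
have [hp|] := ltP 0 h.
  have th : t - h <= t by lra.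
  have /(tail_sub th) : forall x, t - h <= x <= t -> f t - e <= f x <= f t + e.
    move=> x /andP[x1 x2]; apply: near_f.
    by rewrite (gtr0_norm hp) ler0_norm; lra.
  rewrite opprB addrCA subrr addr0 => /andP[h1 h2].
  by rewrite ler_distlC ler_pdivlMr// ler_pdivrMr// h1 h2.
(* For negative [h] the interval is [[t, t - h]], and the signs of numerator and denominator are
   both flipped. *)
rewrite le_eqVlt (negbTE h0)/= => hn.
have th : t <= t - h by lra.
have /(tail_sub th) : forall x, t <= x <= t - h -> f t - e <= f x <= f t + e.
  move=> x /andP[x1 x2]; apply: near_f.
  by rewrite (ltr0_norm hn) ger0_norm; lra.
have -> : t - h - t = - h by lra.
have hp : 0 < - h by lra.
move=> /andP[h1 h2].
have -> : (tail (t - h) - tail t) / h = (tail t - tail (t - h)) / - h.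
  by rewrite invrN mulrN -mulNr opprB.
by rewrite ler_distlC ler_pdivlMr// ler_pdivrMr// h1 h2.
Qed.

(** Points are null for a measure with a density, so the endpoint [t] does not matter. *)
Lemma tail_sandwich (S : set R) t : measurable S ->
  `]t, +oo[%classic `<=` S -> S `<=` `[t, +oo[%classic -> nu S = (tail t)%:E.
Proof.
move=> mS tS St; rewrite fineK ?fin_num_measure//.
apply/eqP; rewrite eq_le le_measure ?inE//=.
rewrite -(setU1itv (x := t) (a := +oo%O) false)// measureU//.
- by rewrite [X in (X + _)%E](density_set1 t) add0e le_measure ?inE.
- by apply/seteqP; split => x //= [] /= ->; rewrite in_itv/= ltxx.
Qed.

Lemma translate_tail (S : set R) a t : up_closed S ->
  `]t, +oo[%classic `<=` S -> S `<=` `[t, +oo[%classic ->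
  translate nu a S = (tail (t - a))%:E.
Proof.
move=> uS tS St; apply: (@tail_sandwich (shift_by a @^-1` S)).
- by apply: up_closed_measurable; exact: up_closed_shift.
- move=> x /=; rewrite in_itv/= andbT => xt.
  by apply: tS; rewrite /= in_itv/= andbT /shift_by; lra.
- by move=> x /St /=; rewrite !in_itv/= !andbT /shift_by; lra.
Qed.

End tail.

Lemma up_closed_minkowski {R : realType} (S : set R) (r : R) : up_closed S ->
  up_closed (minkowski_sum S `[- r, r]).
Proof.
move=> uS _ y [s Ss [u ur <-]] le_y.
by exists (y - u); [apply: uS Ss _; lra|exists u => //; rewrite subrK].
Qed.

Section translates.
Context {R : realType} (nu : probability R R) (f : R -> R).
Hypothesis nuf : has_density nu f.
Hypothesis cf : continuous f.
Context (M : R).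
Hypothesis fM : forall x, `|f x| <= M.

Let mass a (S : set R) := fine (translate nu a S).
Let content a (S : set R) := lower_minkowski_content (translate nu a) S.

Lemma translate_lipschitz (S : set R) a b : up_closed S ->
  `|mass a S - mass b S| <= M * `|a - b|.
Proof.
have M0 : 0 <= M by apply: le_trans (fM 0).
move=> uS; case: (up_closed_cases uS) => [->|->|[t [tS St]]].
- by rewrite /mass !measure0 subrr normr0 mulr_ge0.
- by rewrite /mass !probability_setT subrr normr0 mulr_ge0.
- rewrite /mass !(translate_tail nuf _ uS tS St)/=.
  apply: le_trans (tail_lipschitz nuf fM _ _) _.
  by rewrite opprB addrC addrA subrK distrC addrC.
Qed.

(** The content and the two-sided derivative of the mass are obtained together. Their common value
    is 0 for the empty set and the line, and [f (t - a)] when [S] has boundary point [t]. *)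
Lemma translate_content (S : set R) a : up_closed S ->
  exists d : R, [/\ 0 <= d <= M, content a S = d%:E &
    (mass (a + h) S - mass a S) / h @[h --> 0^'] --> d].
Proof.
have M0 : 0 <= M by apply: le_trans (fM 0).
move=> uS; case: (up_closed_cases uS) => [S0|ST|[t [tS St]]].
- exists 0; split; first by rewrite lexx.
    rewrite /content /lower_minkowski_content S0; apply: cvg_limf_einf.
    rewrite [X in X x @[x --> _]](_ : _ = fun=> 0%E); first exact: cvg_cst.
    apply/funext => r; rewrite [minkowski_sum _ _](_ : _ = set0).
      by rewrite measure0 sube0 mul0e.
    by apply/seteqP; split => // x [].
  rewrite S0 /mass; under eq_fun do rewrite !measure0 subrr mul0r.
  exact: cvg_cst.
- exists 0; split; first by rewrite lexx.
    rewrite /content /lower_minkowski_content ST; apply: cvg_limf_einf.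
    apply: (@cvg_trans _ (0%E @[x --> (0:R)^'+])); last exact: cvg_cst.
    apply: near_eq_cvg; near=> r; rewrite [minkowski_sum _ _](_ : _ = setT).
      by rewrite probability_setT subee// mul0e.
    rewrite -subTset => x _; exists x => //; exists 0; last by rewrite addr0.
    by rewrite /= in_itv/= oppr_le0 andbb.
  rewrite ST /mass; under eq_fun do rewrite !probability_setT subrr mul0r.
  exact: cvg_cst.
- have [_ f0 _] := nuf.
  have mq : (mass (a + h) S - mass a S) / h @[h --> 0^'] --> f (t - a).
    have massE b : mass b S = upper_tail nu (t - b).
      by rewrite /mass (translate_tail nuf _ uS tS St).
    under eq_fun do rewrite !massE opprD addrA.
    exact: tail_derive.
  exists (f (t - a)); split => //.
    by rewrite f0/= (le_trans (ler_norm _)).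
  apply: cvg_limf_einf.
  (* For [r > 0] the enlargement of [S] has boundary point [t - r]. Its mass under the translate by
     [a] is thus that of [S] under the translate by [a + r], and the Minkowski quotient is exactly a
     difference quotient. *)
  apply: (@cvg_trans _ (((mass (a + h) S - mass a S) / h)%:E @[h --> (0:R)^'+])).
    apply: near_eq_cvg; near=> r.
    have r0 : 0 < r by [].
    have h1 : `]t - r, +oo[%classic `<=` minkowski_sum S `[- r, r].
      move=> x /=; rewrite in_itv/= andbT => tx; exists (x + r).
        by apply: tS; rewrite /= in_itv/= andbT; lra.
      by exists (- r); [rewrite /= in_itv/= lexx/=; lra|rewrite addrK].
    have h2 : minkowski_sum S `[- r, r] `<=` `[t - r, +oo[%classic.
      move=> _ [s /St + [u + <-]]; rewrite /= !in_itv/= !andbT => ts /andP[ru _].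
      by lra.
    rewrite (translate_tail nuf _ (up_closed_minkowski uS) h1 h2).
    rewrite /mass !(translate_tail nuf _ uS tS St)/= EFinM EFinB.
    by rewrite opprD addrAC addrA.
  apply: cvg_EFin; first by apply: nearW.
  exact: cvg_dnbhs_at_right.
Unshelve. all: by end_near. Qed.

End translates.

(** * Integrals against a moving translate *)

Section translate_integral.
Context {R : realType} (nu : probability R R) (f : R -> R).
Hypothesis nuf : has_density nu f.
Hypothesis cf : continuous f.

(** The integrand varies with [k] and is only bounded, so weak convergence of the translates would
    not suffice. The difference is at most [K] times the L^1 distance of the two densities. *)
Lemma translate_integral_cvg (a : R) (h : nat -> R) (q : nat -> R -> R) K :
  h k @[k --> \oo] --> 0 ->
  (forall k, measurable_fun setT (q k)) -> (forall k x, `|q k x| <= K) ->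
  \int[translate nu (a + h k)]_x q k x - \int[translate nu a]_x q k x
    @[k --> \oo] --> 0.
Proof.
move=> h0 mq qK.
pose fa b x := f (x - b).
have dens b : has_density (translate nu b) (fa b) by exact: translate_density.
have ifa b : lebesgue_measure.-integrable setT (EFin \o fa b).
  exact: has_density_integrable (dens b).
have mfa b : measurable_fun setT (fa b) by have [] := dens b.
have fa0 b x : 0 <= fa b x by have [_ + _] := dens b; exact.
have intfa b : \int[lebesgue_measure]_x fa b x = 1.
  have [_ _ densE] := dens b.
  by rewrite /Rintegral -densE// probability_setT.
have iqfa k b : lebesgue_measure.-integrable setT (EFin \o (fun x => q k x * fa b x)).
  apply: (@le_integrable _ _ _ lebesgue_measure setT measurableT _
    (EFin \o (fun x => K * fa b x))).
  - by apply/measurable_EFinP; apply: measurable_funM; [exact: mq|exact: mfa].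
  - move=> x _; rewrite /= lee_fin !normrM ler_wpM2r//.
    by rewrite (le_trans (qK k x))// ler_norm.
  - by have := integrableZl measurableT K (ifa b).
have qE k b : \int[translate nu b]_x q k x = \int[lebesgue_measure]_x (q k x * fa b x).
  rewrite /Rintegral (integral_has_density (dens b))//.
  by apply: bounded_integrable (qK k).
(* Continuity of [f] gives the pointwise convergence of the translated densities, all of which have
   integral 1. *)
have Hs : \int[lebesgue_measure]_x `|fa (a + h k) x - fa a x| @[k --> \oo] --> 0.
  apply: scheffe => // [k|x]; first by rewrite !intfa.
  apply: continuous_cvg; first exact: cf.
  rewrite -[X in _ --> x - X]addr0; apply: cvgB; first exact: cvg_cst.
  by apply: cvgD => //; exact: cvg_cst.
apply: (@squeeze_cvgr _ _ _ _
  (fun k => - (K * \int[lebesgue_measure]_x `|fa (a + h k) x - fa a x|))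
  (fun k => K * \int[lebesgue_measure]_x `|fa (a + h k) x - fa a x|)).
- apply: nearW => k; rewrite -ler_norml !qE -RintegralB//.
  have iB : lebesgue_measure.-integrable setT
      (EFin \o (fun x => fa (a + h k) x - fa a x)).
    by have := integrableB measurableT (ifa (a + h k)) (ifa a).
  apply: le_trans (le_normr_Rintegral _ _) _ => //.
    by have := integrableB measurableT (iqfa k (a + h k)) (iqfa k a).
  have iA : lebesgue_measure.-integrable setT
      (EFin \o (fun x => `|fa (a + h k) x - fa a x|)).
    by have := integrable_abse iB.
  rewrite -RintegralZl//; apply: le_Rintegral => //.
  + have := integrableB measurableT (iqfa k (a + h k)) (iqfa k a).
    by move=> /integrable_abse.
  + by have := integrableZl measurableT K iA.
  + by move=> x _; rewrite -mulrBr normrM ler_wpM2r.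
- by rewrite -oppr0; apply: cvgN; rewrite -(mulr0 K); apply: cvgMl_tmp.
- by rewrite -(mulr0 K); apply: cvgMl_tmp.
Qed.

End translate_integral.

(** * Borel increasing sets *)

Section sections.
Context {d} {T : measurableType d} {n : nat}.
Implicit Type B : set (n.+1.-tuple T).

Definition head_section B (y : T) : set (n.-tuple T) :=
  [set x | B (cons_pair (y, x))].

Definition tail_section B (x : n.-tuple T) : set T :=
  [set y | B (cons_pair (y, x))].

End sections.

Section power_probability_fubini.
Context d (T : measurableType d) (R : realType) (P : probability T R) (n : nat).
Local Notation Pn := (power_probability P n).
Local Notation PSn := (power_probability P n.+1).
Implicit Type B : set (n.+1.-tuple T).

Lemma measurable_preimage_cons B : measurable B ->
  measurable (@cons_pair d T n @^-1` B).
Proof.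
by move=> mB; rewrite -[X in measurable X]setTI; exact: measurable_cons_pair.
Qed.

Lemma head_sectionE B y :
  head_section B y = xsection (@cons_pair d T n @^-1` B) y.
Proof. by rewrite xsectionE. Qed.

Lemma tail_sectionE B x :
  tail_section B x = ysection (@cons_pair d T n @^-1` B) x.
Proof. by rewrite ysectionE. Qed.

Lemma measurable_head_section B y : measurable B -> measurable (head_section B y).
Proof.
move=> mB; rewrite head_sectionE; apply: measurable_xsection.
exact: measurable_preimage_cons.
Qed.

Lemma measurable_tail_section B x : measurable B -> measurable (tail_section B x).
Proof.
move=> mB; rewrite tail_sectionE; apply: measurable_ysection.
exact: measurable_preimage_cons.
Qed.

Lemma measurable_fun_head_section (Q : probability (n.-tuple T) R) B :
  measurable B -> measurable_fun setT (fun y => Q (head_section B y)).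
Proof.
move=> mB; under eq_fun do rewrite head_sectionE.
by apply: measurable_fun_xsection; exact: measurable_preimage_cons.
Qed.

Lemma measurable_fun_tail_section (Q : probability T R) B :
  measurable B -> measurable_fun setT (fun x => Q (tail_section B x)).
Proof.
move=> mB; under eq_fun do rewrite tail_sectionE.
by apply: measurable_fun_ysection; exact: measurable_preimage_cons.
Qed.

Lemma power_probability_head B : measurable B ->
  PSn B = (\int[P]_y Pn (head_section B y))%E.
Proof. by move=> mB; apply: eq_integral => y _; rewrite /= -head_sectionE. Qed.

(** Both sides are values of the product of [P] and [Q]. The measure [Q] is arbitrary because the
    induction mixes one translate on the first coordinate with another on the remaining ones. *)
Lemma integral_section_swap (Q : probability (n.-tuple T) R) B : measurable B ->
  (\int[P]_y Q (head_section B y) = \int[Q]_x P (tail_section B x))%E.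
Proof.
move=> mB; under eq_integral do rewrite head_sectionE.
under [RHS]eq_integral do rewrite tail_sectionE.
have := @product_measure_unique _ _ _ _ _ P Q (product_measure2 P Q).
apply; last exact: measurable_preimage_cons.
by move=> ? ? ? ?; exact: product_measure2E.
Qed.

Lemma power_probability_tail B : measurable B ->
  PSn B = (\int[Pn]_x P (tail_section B x))%E.
Proof. by move=> mB; rewrite power_probability_head// integral_section_swap. Qed.

Lemma integral_power_probability_head (g : n.+1.-tuple T -> \bar R) :
  measurable_fun setT g -> (forall z, 0 <= g z)%E ->
  (\int[PSn]_z g z = \int[P]_y \int[Pn]_x g (cons_pair (y, x)))%E.
Proof.
move=> mg g0; have mgc : measurable_fun setT (g \o @cons_pair d T n).
  by apply: measurableT_comp => //; exact: measurable_cons_pair.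
rewrite ge0_integral_distribution// fubini_tonelli1//.
by move=> z; exact: g0.
Qed.

Lemma integral_power_probability_tail (g : n.+1.-tuple T -> \bar R) :
  measurable_fun setT g -> (forall z, 0 <= g z)%E ->
  (\int[PSn]_z g z = \int[Pn]_x \int[P]_y g (cons_pair (y, x)))%E.
Proof.
move=> mg g0; have mgc : measurable_fun setT (g \o @cons_pair d T n).
  by apply: measurableT_comp => //; exact: measurable_cons_pair.
rewrite ge0_integral_distribution// fubini_tonelli2//.
by move=> z; exact: g0.
Qed.

Lemma measurable_fun_cons_integral (Q : probability (n.-tuple T) R)
    (g : n.+1.-tuple T -> \bar R) :
  measurable_fun setT g -> (forall z, 0 <= g z)%E ->
  measurable_fun setT (fun y => \int[Q]_x g (cons_pair (y, x)))%E.
Proof.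
move=> mg g0; apply: (@measurable_fun_fubini_tonelli_F _ _ _ _ _ Q
  (fun z => g (cons_pair z))) => //.
by apply: measurableT_comp => //; exact: measurable_cons_pair.
Qed.

End power_probability_fubini.

(** * Fibers and sections of increasing sets *)

Section monotone_sections.
Context {R : realType}.

Lemma fiber_head n (B : set (n.+1.-tuple R)) y x :
  fiber B ord0 (cons_pair (y, x)) = tail_section B x.
Proof.
apply/seteqP; split=> w; rewrite /fiber /tail_section /=;
  congr (B _ : Prop); apply: eq_from_tnth => i; rewrite tnth_mktuple;
  by case: (unliftP ord0 i) => [j ->|->]; rewrite ?eqxx ?tnth0//= !tnthS.
Qed.

Lemma fiber_tail n (B : set (n.+1.-tuple R)) y x (j : 'I_n) :
  fiber B (lift ord0 j) (cons_pair (y, x)) = fiber (head_section B y) j x.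
Proof.
apply/seteqP; split=> w; rewrite /fiber /head_section /=;
  congr (B _ : Prop); apply: eq_from_tnth => i; rewrite tnth_mktuple;
  case: (unliftP ord0 i) => [k ->|->]; rewrite ?tnth0//= !tnthS tnth_mktuple;
  by rewrite (inj_eq lift_inj).
Qed.

Lemma monotone_head_section n (B : set (n.+1.-tuple R)) y :
  monotone_increasing B -> monotone_increasing (head_section B y).
Proof.
move=> mB u v Bu uv; apply: mB Bu _ => i.
by case: (unliftP ord0 i) => [k ->|->]; rewrite ?tnth0 ?tnthS.
Qed.

Lemma monotone_fiber n (B : set (n.-tuple R)) i x :
  monotone_increasing B -> up_closed (fiber B i x).
Proof.
move=> mB u v Bu uv; apply: mB Bu _ => j.
by rewrite !tnth_mktuple; case: ifP.
Qed.

Lemma measurable_fun_fiber n (P : probability R R) (B : set (n.-tuple R)) i :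
  measurable B -> measurable_fun setT (fun z => P (fiber B i z)).
Proof.
move=> mB.
(* With [upd] overwriting coordinate [i], the fiber through [z] is the section at [z] of the
   preimage of [B], so measurability reduces to that of section measures. *)
pose upd (yz : R * n.-tuple R) := [tuple if j == i then yz.1 else tnth yz.2 j | j < n].
have mupd : measurable_fun setT upd.
  apply/measurable_fun_tnthP => j.
  apply: (eq_measurable_fun (fun yz => if j == i then yz.1 else tnth yz.2 j)).
    by move=> yz _; rewrite /= tnth_mktuple.
  case: (j == i); first exact: measurable_fst.
  exact: (measurableT_comp (measurable_tnth j) measurable_snd).
rewrite [X in measurable_fun _ X](_ : _ = P \o ysection (upd @^-1` B)).
  by apply: measurable_fun_ysection; rewrite -[X in measurable X]setTI; exact: mupd.
by apply/funext => z; rewrite /= ysectionE.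
Qed.

(** Fubini in direction [i]. The fiber through [z] ignores coordinate [i] of [z], so integrating
    over that coordinate too only contributes the factor [P setT = 1]. *)
Lemma power_probability_fiber n (P : probability R R) (B : set (n.-tuple R)) i :
  measurable B ->
  power_probability P n B = (\int[power_probability P n]_z P (fiber B i z))%E.
Proof.
elim: n B i => [|n IH] B i mB; first by case: i.
have mf := measurable_fun_fiber P i mB.
case: (unliftP ord0 i) mf => [j ->|->] mf.
  rewrite integral_power_probability_head// power_probability_head//.
  apply: eq_integral => y _; rewrite (IH _ j); last exact: measurable_head_section.
  by apply: eq_integral => x _; rewrite fiber_tail.
rewrite integral_power_probability_tail// power_probability_tail//.
apply: eq_integral => x _; under eq_integral do rewrite fiber_head.
by rewrite integral_cst// [X in (_ * X)%E](@probability_setT _ _ _ P) mule1.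
Qed.

End monotone_sections.

(** * The derivative formula for Borel increasing sets *)

Section borel_monotone_sets.
Context {R : realType} (nu : probability R R) (f : R -> R).
Hypothesis nuf : has_density nu f.
Hypothesis cf : continuous f.
Context (M : R).
Hypothesis fM : forall x, `|f x| <= M.

Local Notation eta := (translate nu).
Local Notation content a := (lower_minkowski_content (eta a)).
Local Notation P a n := (power_probability (eta a) n).

Let mass a (S : set R) := fine (eta a S).

Lemma content_bounds a (S : set R) : up_closed S -> (0 <= content a S <= M%:E)%E.
Proof.
move=> uS; have [d [dM dE _]] := translate_content nuf cf fM a uS.
by rewrite dE !lee_fin.
Qed.

Lemma content_quotient a (S : set R) (h : nat -> R) : up_closed S ->
  (forall k, h k != 0) -> h k @[k --> \oo] --> 0 ->
  (mass (a + h k) S - mass a S) / h k @[k --> \oo] --> fine (content a S).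
Proof.
move=> uS h0 hcvg; have [d [_ dE]] := translate_content nuf cf fM a uS.
by rewrite dE => /cvgr_dnbhsP; apply.
Qed.

Lemma mass_quotient_bound a h (S : set R) : up_closed S -> h != 0 ->
  `|(mass (a + h) S - mass a S) / h| <= M.
Proof.
move=> uS h0; rewrite normrM normfV ler_pdivrMr ?normr_gt0//.
rewrite (le_trans (translate_lipschitz nuf fM (a + h) a uS))//.
by rewrite addrAC subrr add0r.
Qed.

(** The content is a pointwise limit of difference quotients of masses of fibers, taken along the
    steps [1/(k+1)]. *)
Lemma measurable_fun_content n (B : set (n.-tuple R)) i a :
  measurable B -> monotone_increasing B ->
  measurable_fun setT (fun z => content a (fiber B i z)).
Proof.
move=> mB iB; pose h k : R := k.+1%:R^-1.
have h0 k : h k != 0 by rewrite invr_eq0 pnatr_eq0.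
apply: (@emeasurable_fun_cvg _ _ _ _ (fun k z =>
  ((mass (a + h k) (fiber B i z) - mass a (fiber B i z)) / h k)%:E)).
  move=> k; apply/measurable_EFinP; apply: measurable_funM => //.
  by apply: measurable_funB; apply: measurableT_comp; rewrite //;
    exact: measurable_fun_fiber.
move=> z _; have uS := @monotone_fiber _ _ _ i z iB.
have [d [_ dE _]] := translate_content nuf cf fM a uS.
have -> : content a (fiber B i z) = (fine (content a (fiber B i z)))%:E.
  by rewrite dE.
apply: cvg_EFin; first exact: nearW.
by apply: content_quotient => //; exact: cvg_harmonic.
Qed.

Lemma influence_bounds n (B : set (n.-tuple R)) i a :
  measurable B -> monotone_increasing B ->
  (0 <= \int[P a n]_x content a (fiber B i x) <= M%:E)%E.
Proof.
move=> mB iB.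
have cb x := @content_bounds a _ (@monotone_fiber _ _ _ i x iB).
apply/andP; split; first by apply: integral_ge0 => x _; have /andP[] := cb x.
apply: (@le_trans _ _ (\int[P a n]_x (cst M%:E x))%E); last first.
  by rewrite integral_cst// [X in (_ * X)%E](@probability_setT _ _ _ (P a n)) mule1.
apply: ge0_le_integral => //.
- by move=> x _; have /andP[] := cb x.
- exact: measurable_fun_content.
- by move=> x _; have /andP[] := cb x.
Qed.

Lemma power_probability_Rintegral_head n (B : set (n.+1.-tuple R)) b :
  measurable B -> fine (P b n.+1 B) =
  \int[eta b]_y fine (P b n (head_section B y)).
Proof.
move=> mB; rewrite power_probability_head//; congr fine.
apply: eq_integral => y _; rewrite fineK// fin_num_measure//.
exact: measurable_head_section.
Qed.

Lemma power_probability_Rintegral_tail n (B : set (n.+1.-tuple R)) a b :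
  measurable B -> 
  \int[eta b]_y fine (P a n (head_section B y)) =
  \int[P a n]_x mass b (tail_section B x).
Proof.
move=> mB; congr fine.
transitivity (\int[eta b]_y P a n (head_section B y))%E.
  apply: eq_integral => y _; rewrite fineK// fin_num_measure//.
  exact: measurable_head_section.
transitivity (\int[P a n]_x eta b (tail_section B x))%E; last first.
  apply: eq_integral => x _; rewrite fineK// fin_num_measure//.
  exact: measurable_tail_section.
exact: integral_section_swap.
Qed.

(** The intermediate value is the measure of [B] when the first coordinate follows the translate by
    [b] and the others that by [a]. The first integral moves the last [n] coordinates, the second
    moves the first one. *)
Lemma power_probability_split n (B : set (n.+1.-tuple R)) a b :
  measurable B ->
  fine (P b n.+1 B) - fine (P a n.+1 B) =
  \int[eta b]_y (fine (P b n (head_section B y)) - fine (P a n (head_section B y)))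
  + \int[P a n]_x (mass b (tail_section B x) - mass a (tail_section B x)).
Proof.
move=> mB.
have iG b' c : (eta b').-integrable setT
    (EFin \o (fun y => fine (P c n (head_section B y)))).
  apply: (@bounded_integrable _ _ _ _ _ 1).
    apply: measurableT_comp; first exact: fine_measurable.
    exact: measurable_fun_head_section.
  by move=> y; apply: fine_probability_le1; exact: measurable_head_section.
have it c b' : (P c n).-integrable setT
    (EFin \o (fun x => mass b' (tail_section B x))).
  apply: (@bounded_integrable _ _ _ _ _ 1).
    apply: measurableT_comp; first exact: fine_measurable.
    exact: measurable_fun_tail_section.
  by move=> y; apply: fine_probability_le1; exact: measurable_tail_section.
have /= -> := RintegralB measurableT (iG b b) (iG b a).
have /= -> := RintegralB measurableT (it a b) (it a a).
rewrite (power_probability_Rintegral_head b mB).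
rewrite (power_probability_Rintegral_head a mB).
rewrite -(power_probability_Rintegral_tail a b mB).
by rewrite -(power_probability_Rintegral_tail a a mB) addrA subrK.
Qed.

(** Matches the two terms of [power_probability_split]: the influence of the first coordinate comes
    from the tail sections, and the other influences are averages of those of the head sections. *)
Lemma influence_sum_head n (B : set (n.+1.-tuple R)) a :
  measurable B -> monotone_increasing B ->
  (\sum_(i < n.+1) \int[P a n.+1]_z content a (fiber B i z) =
   \int[P a n]_x content a (tail_section B x) +
   \int[eta a]_y \sum_(i < n) \int[P a n]_x content a (fiber (head_section B y) i x))%E.
Proof.
move=> mB iB.
have mc i : measurable_fun setT (fun z => content a (fiber B i z)).
  exact: measurable_fun_content.
have c0 i z : (0 <= content a (fiber B i z))%E.
  by have /andP[] := content_bounds a (@monotone_fiber _ _ _ i z iB).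
rewrite big_ord_recl; congr (_ + _)%E.
  rewrite (integral_power_probability_tail _ (mc ord0) (c0 ord0)).
  apply: eq_integral => x _; under eq_integral do rewrite fiber_head.
  by rewrite integral_cst// [X in (_ * X)%E](@probability_setT _ _ _ (eta a)) mule1.
rewrite ge0_integral_sum//.
- apply: eq_bigr => i _.
  rewrite (integral_power_probability_head _ (mc (lift ord0 i)) (c0 (lift ord0 i))).
  by apply: eq_integral => y _; apply: eq_integral => x _; rewrite fiber_tail.
- move=> i; under eq_fun do under eq_integral do rewrite -fiber_tail.
  exact: (measurable_fun_cons_integral (P a n) (mc (lift ord0 i)) (c0 _)).
- move=> i y _; apply: integral_ge0 => x _.
  have iBy := monotone_head_section (y := y) iB.
  by have /andP[] := content_bounds a (@monotone_fiber _ _ _ i x iBy).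
Qed.

Lemma influence_sum_bounds n (B : set (n.-tuple R)) a :
  measurable B -> monotone_increasing B ->
  (0 <= \sum_(i < n) \int[P a n]_x content a (fiber B i x) <= (n%:R * M)%:E)%E.
Proof.
move=> mB iB; apply/andP; split.
  by apply: sume_ge0 => i _; have /andP[] := @influence_bounds _ _ i a mB iB.
apply: (@le_trans _ _ (\sum_(i < n) M%:E)%E).
  by apply: lee_sum => i _; have /andP[] := @influence_bounds _ _ i a mB iB.
by rewrite sumEFin lee_fin big_const_ord iter_addr_0 mulr_natl.
Qed.

(** The Lipschitz bound belongs to the induction because it bounds the difference quotients of the
    head sections uniformly. Limits are taken along sequences to suit dominated convergence. *)
Theorem borel_power_probability n (B : set (n.-tuple R)) :
  measurable B -> monotone_increasing B ->
  (forall a b, `|fine (P a n B) - fine (P b n B)| <= n%:R * M * `|a - b|) /\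
  (forall a (h : nat -> R), (forall k, h k != 0) -> h k @[k --> \oo] --> 0 ->
    (fine (P (a + h k) n B) - fine (P a n B)) / h k @[k --> \oo] -->
    fine (\sum_(i < n) \int[P a n]_x content a (fiber B i x))%E).
Proof.
elim: n B => [|n IH] B mB iB.
  split=> [a b|a h _ _]; first by rewrite subrr normr0 !mul0r.
  by rewrite big_ord0; under eq_fun do rewrite subrr mul0r; exact: cvg_cst.
have mH y := measurable_head_section y mB.
have iH y : monotone_increasing (head_section B y) by exact: monotone_head_section.
have uT x : up_closed (tail_section B x).
  by move=> y z By yz; apply: iB By _ => i;
    case: (unliftP ord0 i) => [j ->|->]; rewrite ?tnthS ?tnth0.
pose G b y := fine (P b n (head_section B y)).
have mG b : measurable_fun setT (G b).
  apply: measurableT_comp; first exact: fine_measurable.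
  exact: measurable_fun_head_section.
have mt b : measurable_fun setT (fun x : n.-tuple R => mass b (tail_section B x)).
  apply: measurableT_comp; first exact: fine_measurable.
  exact: measurable_fun_tail_section.
split=> [a b|a h h0 hcvg].
  rewrite power_probability_split// -[n.+1]addn1 natrD mulrDl mul1r mulrDl.
  apply: le_trans (ler_normD _ _) _; apply: lerD.
    apply: bounded_Rintegral; first exact: measurable_funB (mG a) (mG b).
    by move=> y; have [+ _] := IH _ (mH y) (iH y); apply.
  apply: bounded_Rintegral; first exact: measurable_funB (mt a) (mt b).
  by move=> x; exact: (translate_lipschitz nuf fM).
pose q k y := (G (a + h k) y - G a y) / h k.
have mq k : measurable_fun setT (q k).
  by apply: measurable_funM => //; exact: measurable_funB.
have qK k y : `|q k y| <= n%:R * M.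
  rewrite normrM normfV ler_pdivrMr ?normr_gt0//.
  have [/(_ (a + h k) a) + _] := IH _ (mH y) (iH y).
  by rewrite addrAC subrr add0r.
pose g y := fine (\sum_(i < n) \int[P a n]_x content a (fiber (head_section B y) i x))%E.
have qg y : q k y @[k --> \oo] --> g y.
  by have [_] := IH _ (mH y) (iH y); apply.
have q_cvg : \int[eta a]_y q k y @[k --> \oo] --> \int[eta a]_y g y.
  exact: bounded_convergence qg.
(* Here the moving measure is exchanged for the fixed one; the error vanishes since [q] is uniformly
   bounded. *)
have qh_cvg : \int[eta (a + h k)]_y q k y @[k --> \oo] --> \int[eta a]_y g y.
  rewrite -[X in _ --> X]add0r.
  rewrite [X in X @ _](_ : _ = fun k =>
    (\int[eta (a + h k)]_y q k y - \int[eta a]_y q k y) +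
    \int[eta a]_y q k y); last first.
    by apply/funext => k; rewrite subrK.
  by apply: cvgD q_cvg; exact: (translate_integral_cvg nuf cf a hcvg mq qK).
pose t k x := (mass (a + h k) (tail_section B x) - mass a (tail_section B x)) / h k.
have t_cvg : \int[P a n]_x t k x @[k --> \oo] -->
    \int[P a n]_x fine (content a (tail_section B x)).
  apply: (@bounded_convergence _ _ _ _ _ _ M).
  - by move=> k; apply: measurable_funM => //; exact: measurable_funB.
  - by move=> k x; apply: mass_quotient_bound.
  - by move=> x; exact: content_quotient.
(* All influences are at most [M], so the extended sums are finite and [fine] distributes over
   them. *)
have -> : fine (\sum_(i < n.+1) \int[P a n.+1]_x content a (fiber B i x))%E =
    \int[eta a]_y g y + \int[P a n]_x fine (content a (tail_section B x)).
  have : (\sum_(i < n.+1) \int[P a n.+1]_x content a (fiber B i x))%E \is a fin_num.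
    have /andP[s0 sM] := influence_sum_bounds a mB iB.
    by rewrite ge0_fin_numE// (le_lt_trans sM)// ltry.
  rewrite influence_sum_head// fin_numD => /andP[f1 f2].
  rewrite fineD// addrC; congr (fine _ + fine _).
    apply: eq_integral => y _; rewrite fineK//.
    have /andP[s0 sM] := influence_sum_bounds a (mH y) (iH y).
    by rewrite ge0_fin_numE// (le_lt_trans sM)// ltry.
  apply: eq_integral => x _; rewrite fineK//.
  have /andP[s0 sM] := content_bounds a (uT x).
  by rewrite ge0_fin_numE// (le_lt_trans sM)// ltry.
have -> : (fun k => (fine (P (a + h k) n.+1 B) - fine (P a n.+1 B)) / h k) =
    (fun k => \int[eta (a + h k)]_y q k y + \int[P a n]_x t k x).
  apply/funext => k; rewrite power_probability_split// mulrDl.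
  rewrite -!RintegralZr//.
  - apply: (@bounded_integrable _ _ _ _ _ (M * `|a + h k - a|)).
      exact: measurable_funB.
    by move=> x; exact: (translate_lipschitz nuf fM).
  - apply: (@bounded_integrable _ _ _ _ _ (n%:R * M * `|a + h k - a|)).
      exact: measurable_funB (mG _) (mG _).
    by move=> y; have [+ _] := IH _ (mH y) (iH y); apply.
exact: cvgD.
Qed.

End borel_monotone_sets.

(** * Arbitrary increasing sets *)

Section completion.
Context d (T : measurableType d) (R : realType).
Variable mu : {measure set T -> \bar R}.
Local Notation cmu := (@completed_measure_extension _ _ _ mu).

(** The completed measure is the restriction of an outer measure, so its value at [A] is defined and
    monotone without any measurability of [A]. *)
Lemma completed_sandwich (B A C : set T) : measurable B -> measurable C ->
  B `<=` A -> A `<=` C -> mu C = mu B -> cmu A = mu B.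
Proof.
move=> mB mC BA AC CB; apply/eqP; rewrite eq_le; apply/andP; split.
  by rewrite -CB -(measurable_mu_extE mu mC); exact: le_mu_ext.
by rewrite -(measurable_mu_extE mu mB); exact: le_mu_ext.
Qed.

Lemma integral_completed (g h : T -> \bar R) (N : set T) :
  measurable_fun setT g -> (forall x, 0 <= g x)%E ->
  measurable N -> mu N = 0%E -> (forall x, ~ N x -> h x = g x) ->
  (\int[cmu]_x h x = \int[mu]_x g x)%E.
Proof.
move=> mg g0 mN N0 hg.
pose I := caratheodory_type (mu^*)%mu.
(* [I] is [T] with the Caratheodory sigma-algebra. The identity to [T] is measurable and pushes the
   completed measure to [mu]; completeness makes [h] measurable on [I]. *)
have mid : measurable_fun setT (idfun : I -> T).
  by move=> _ Y mY; rewrite setTI; exact: caratheodory_measurable_mu_ext.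
have mgI : measurable_fun setT (g : I -> \bar R).
  exact: (measurableT_comp mg mid).
have gh : ae_eq cmu setT (g : I -> \bar R) h.
  exists N; split.
  - exact: caratheodory_measurable_mu_ext.
  - by rewrite -N0; exact: (measurable_mu_extE mu mN).
  - by move=> x /= gh; apply: contrapT => /hg hgx; apply: gh.
have mh : measurable_fun setT (h : I -> \bar R).
  by apply: (ae_measurable_fun _ gh mgI); exact: measure_is_complete_caratheodory.
rewrite -(ae_eq_integral _ _ measurableT mgI mh gh).
have := @ge0_integral_pushforward _ _ _ _ _ _ mid cmu setT g measurableT mg
  (fun x _ => g0 x).
rewrite preimage_setT => <-; apply: eq_measure_integral => A mA _.
exact: measurable_mu_extE.
Qed.

End completion.

(** * Borel sets enclosing an increasing set *)

Section borel_sandwich.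
Context {R : realType} {n : nat}.
Implicit Types (A : set (n.-tuple R)) (x : n.-tuple R).

Definition translate_tuple (c : R) x : n.-tuple R := [tuple tnth x j + c | j < n].

Lemma measurable_translate_tuple c : measurable_fun setT (translate_tuple c).
Proof.
apply/measurable_fun_tnthP => j.
apply: (eq_measurable_fun (fun x => tnth x j + c)).
  by move=> x _; rewrite /= tnth_mktuple.
by apply: measurable_funD => //; exact: measurable_tnth.
Qed.

Lemma measurable_preimage_translate c A : measurable A ->
  measurable (translate_tuple c @^-1` A).
Proof.
by move=> mA; rewrite -[X in measurable X]setTI; exact: measurable_translate_tuple.
Qed.

(** The inner approximation of an increasing set; having countably many vertices makes it Borel for
    every [A]. *)
Definition rational_hull A : set (n.-tuple R) :=
  \bigcup_q [set x | A [tuple ratr (tnth q j) | j < n] /\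
    forall j : 'I_n, ratr (tnth (q : n.-tuple rat) j) <= tnth x j].

(** The outer approximation: an increasing [A] is contained in this set. *)
Definition shrunk_hull A : set (n.-tuple R) :=
  \bigcap_k (translate_tuple k.+1%:R^-1 @^-1` rational_hull A).

Lemma measurable_rational_hull A : measurable (rational_hull A).
Proof.
apply: countable_bigcupT_measurable => // q.
have [Aq|nAq] := pselect (A [tuple ratr (tnth q j) | j < n]); last first.
  by rewrite (_ : mkset _ = set0)//; apply/seteqP; split => // x [].
rewrite (_ : mkset _ =
    \bigcap_(j in [set: 'I_n])
      ((fun x => tnth x j) @^-1` `[ratr (tnth q j), +oo[%classic)).
  apply: fin_bigcap_measurable => // j _.
  by rewrite -[X in measurable X]setTI; apply: measurable_tnth.
apply/seteqP; split=> x /=; first by move=> [_ qx] j _ /=; rewrite in_itv/= andbT.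
by move=> qx; split => // j; have := qx j I; rewrite /= in_itv/= andbT.
Qed.

Lemma measurable_shrunk_hull A : measurable (shrunk_hull A).
Proof.
apply: bigcapT_measurable => k.
by apply: measurable_preimage_translate; exact: measurable_rational_hull.
Qed.

Lemma monotone_rational_hull A : monotone_increasing (rational_hull A).
Proof.
move=> x y [q _ [Aq qx]] xy; exists q => //; split=> // j.
exact: le_trans (qx j) (xy j).
Qed.

Lemma monotone_shrunk_hull A : monotone_increasing (shrunk_hull A).
Proof.
move=> x y Ax xy k _; apply: (monotone_rational_hull (Ax k I)) => j.
by rewrite !tnth_mktuple lerD2r.
Qed.

Lemma rational_hull_sub A : monotone_increasing A -> rational_hull A `<=` A.
Proof.
by move=> iA x [q _ [Aq qx]]; apply: iA Aq _ => j; rewrite tnth_mktuple.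
Qed.

Lemma sub_shrunk_hull A : monotone_increasing A -> A `<=` shrunk_hull A.
Proof.
move=> iA x Ax k _.
(* These rationals form a vertex above [x], hence in [A], and below the translate of [x] by
   [1/(k+1)]. *)
have H (j : 'I_n) : exists q : rat, tnth x j <= ratr q <= tnth x j + k.+1%:R^-1.
  have : tnth x j < tnth x j + k.+1%:R^-1 by rewrite ltrDl invr_gt0.
  by move=> /rat_in_itvoo[q]; rewrite in_itv/= => /andP[q1 q2]; exists q; rewrite !ltW.
pose q := [tuple projT1 (cid (H j)) | j < n].
exists q => //; split=> [|j].
  by apply: iA Ax _ => j; rewrite !tnth_mktuple; case: cid => r /= /andP[].
by rewrite !tnth_mktuple; case: cid => r /= /andP[].
Qed.

End borel_sandwich.

Lemma power_probability_translate {R : realType} (nu : probability R R) a c n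
    (B : set (n.-tuple R)) : measurable B ->
  power_probability (translate nu (a + c)) n B =
  power_probability (translate nu a) n (translate_tuple c @^-1` B).
Proof.
elim: n B => [|n IH] B mB.
  rewrite (_ : _ @^-1` B = B)//; apply/seteqP; split=> x /=;
    by rewrite (tuple0 (translate_tuple c x)) (tuple0 x).
have mcB := measurable_preimage_translate c mB.
rewrite !power_probability_head//.
set g := fun y => power_probability (translate nu (a + c)) n (head_section B y).
have mg : measurable_fun setT g by exact: measurable_fun_head_section.
transitivity (\int[nu]_x g (shift_by (a + c) x))%E.
  by rewrite ge0_integral_distribution.
transitivity (\int[translate nu a]_y g (shift_by c y))%E.
  rewrite ge0_integral_distribution//.
    by apply: eq_integral => x _; rewrite /= /shift_by addrA.
  by apply: measurableT_comp => //; exact: measurable_shift_by.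
apply: eq_integral => y _; rewrite /g IH; last exact: measurable_head_section.
congr (power_probability _ _ _); apply/seteqP; split=> x /=; rewrite /head_section /=;
  congr (B _ : Prop); apply: eq_from_tnth => i; rewrite !tnth_mktuple;
  by case: (unliftP ord0 i) => [j ->|->]; rewrite ?tnth0// !tnthS tnth_mktuple.
Qed.

(** * From Borel to arbitrary increasing sets *)

Section monotone_sets.
Context {R : realType} (nu : probability R R) (f : R -> R).
Hypothesis nuf : has_density nu f.
Hypothesis cf : continuous f.
Context (M : R).
Hypothesis fM : forall x, `|f x| <= M.

Local Notation eta := (translate nu).
Local Notation content a := (lower_minkowski_content (eta a)).
Local Notation P a n := (power_probability (eta a) n).

Lemma eq_content a (S S' : set R) : up_closed S -> up_closed S' -> S `<=` S' ->
  eta a S = eta a S' -> content a S = content a S'.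
Proof.
move=> uS uS' SS' SE.
have le_mass b : fine (eta b S) <= fine (eta b S').
  have mS := up_closed_measurable uS; have mS' := up_closed_measurable uS'.
  by apply: fine_le; rewrite ?fin_num_measure// le_measure// inE.
pose h k : R := k.+1%:R^-1.
have h_gt0 k : 0 < h k by rewrite invr_gt0.
have hcvg : h k @[k --> \oo] --> 0 by exact: cvg_harmonic.
have Nhcvg : - h k @[k --> \oo] --> 0 by rewrite -oppr0; exact: cvgN.
have h0 k : h k != 0 by rewrite gt_eqF.
have Nh0 k : - h k != 0 by rewrite oppr_eq0.
have q := content_quotient nuf cf fM (a := a) uS h0 hcvg.
have q' := content_quotient nuf cf fM (a := a) uS' h0 hcvg.
have r := content_quotient nuf cf fM (a := a) uS Nh0 Nhcvg.
have r' := content_quotient nuf cf fM (a := a) uS' Nh0 Nhcvg.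
have cE T (uT : up_closed T) : content a T = (fine (content a T))%:E.
  by have [d [_ -> _]] := translate_content nuf cf fM a uT.
(* The masses agree at [a] and those of [S] are never larger. Quotients with positive steps
   therefore give one inequality and quotients with negative steps the other. *)
rewrite (cE _ uS) (cE _ uS'); congr _%:E; apply/eqP; rewrite eq_le; apply/andP; split.
  rewrite -(cvg_lim _ q)// -(cvg_lim _ q')//; apply: ler_lim.
  - by apply/cvg_ex; eexists; exact: q.
  - by apply/cvg_ex; eexists; exact: q'.
  - apply: nearW => k; rewrite SE; apply: ler_wpM2r; last exact: lerB.
    by rewrite invr_ge0 ltW.
rewrite -(cvg_lim _ r)// -(cvg_lim _ r')//; apply: ler_lim.
- by apply/cvg_ex; eexists; exact: r'.
- by apply/cvg_ex; eexists; exact: r.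
- apply: nearW => k; rewrite SE; apply: ler_wnM2r; last exact: lerB.
  by rewrite invr_le0 oppr_le0 ltW.
Qed.

Context {n : nat} {A : set (n.-tuple R)}.
Hypothesis iA : monotone_increasing A.
Local Notation Ai := (rational_hull A).
Local Notation Ao := (shrunk_hull A).

Let mI := measurable_rational_hull A.
Let mO := measurable_shrunk_hull A.
Let iI := @monotone_rational_hull _ _ A.
Let iO := @monotone_shrunk_hull _ _ A.

Lemma hull_sub_shrunk : Ai `<=` Ao.
Proof. by move=> x /(rational_hull_sub iA); exact: sub_shrunk_hull. Qed.

(** Translating [Ao] by [1/(k+1)] lands in [Ai], so the measure of [Ao] at [a] is at most that of
    [Ai] at [a + 1/(k+1)]. By the Lipschitz bound this exceeds the measure of [Ai] at [a] by at most
    [n M / (k+1)]. *)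
Lemma power_probability_hulls a : P a n Ao = P a n Ai.
Proof.
apply/eqP; rewrite eq_le; apply/andP; split; last first.
  by rewrite le_measure// ?inE//; exact: hull_sub_shrunk.
rewrite -(fineK (fin_num_measure (P a n) _ mO)).
rewrite -(fineK (fin_num_measure (P a n) _ mI)) lee_fin.
have [lip _] := borel_power_probability nuf cf fM mI iI.
have Ole k : fine (P a n Ao) <= fine (P a n Ai) + n%:R * M * k.+1%:R^-1.
  apply: (@le_trans _ _ (fine (P (a + k.+1%:R^-1) n Ai))).
    rewrite power_probability_translate//; apply: fine_le.
    - exact: fin_num_measure.
    - by apply: fin_num_measure; exact: measurable_preimage_translate.
    - rewrite le_measure ?inE//; first exact: measurable_preimage_translate.
      by move=> x /(_ k I).
  rewrite -lerBlDl (le_trans (ler_norm _))// (le_trans (lip _ _))//.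
  by rewrite addrAC subrr add0r ger0_norm// invr_ge0.
have c : fine (P a n Ai) + n%:R * M * k.+1%:R^-1 @[k --> \oo] --> fine (P a n Ai).
  rewrite -[X in _ --> X]addr0; apply: cvgD; first exact: cvg_cst.
  by rewrite -(mulr0 (n%:R * M)); apply: cvgMl_tmp; exact: cvg_harmonic.
rewrite -(cvg_lim _ c)//; apply: limr_ge; last exact: nearW.
by apply/cvg_ex; eexists; exact: c.
Qed.

Lemma completed_power_hull a : completed_power (eta a) n A = P a n Ai.
Proof.
apply: (completed_sandwich mI mO _ _ (power_probability_hulls a)).
- exact: rational_hull_sub.
- exact: sub_shrunk_hull.
Qed.

Lemma geometric_influence_hull a i :
  geometric_influence (eta a) A i = (\int[P a n]_x content a (fiber Ai i x))%E.
Proof.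
(* The integral of [gap] is the measure of the null set between the hulls, so [gap] vanishes off a
   null set [N]. Off [N] the fibers of [Ai], [A] and [Ao] have equal mass, hence those of [Ai] and
   [A] have equal content. *)
pose gap x := eta a (fiber (Ao `\` Ai) i x).
have mOI : measurable (Ao `\` Ai) by exact: measurableD.
have mgap : measurable_fun setT gap by exact: measurable_fun_fiber.
have [N [mN N0 gapN]] : ae_eq (P a n) setT gap (cst 0%E).
  apply/(ae_eq_integral_abs _ measurableT mgap).
  transitivity (P a n (Ao `\` Ai)).
    rewrite (power_probability_fiber _ i mOI); apply: eq_integral => x _.
    by rewrite gee0_abs.
  rewrite measureD// ?setIidr.
  - rewrite [X in (X - _)%E](power_probability_hulls a) subee//.
    exact: fin_num_measure.
  - exact: hull_sub_shrunk.
  - by rewrite ltey_eq fin_num_measure.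
apply: (@integral_completed _ _ _ (P a n) _ _ N) => //.
- exact: (measurable_fun_content nuf cf fM i a mI iI).
- move=> x; have uI : up_closed (fiber Ai i x) by exact: monotone_fiber.
  by have /andP[] := content_bounds nuf cf fM a uI.
move=> x Nx.
have gx : gap x = 0%E by apply: contrapT => gx; apply: Nx; apply: gapN => /= /(_ I).
have uI : up_closed (fiber Ai i x) by exact: monotone_fiber.
have uA : up_closed (fiber A i x) by exact: monotone_fiber.
have uO : up_closed (fiber Ao i x) by exact: monotone_fiber.
have IA : fiber Ai i x `<=` fiber A i x by move=> y; exact: rational_hull_sub.
have AO : fiber A i x `<=` fiber Ao i x by move=> y; exact: sub_shrunk_hull.
apply/esym/eq_content => //; apply/eqP; rewrite eq_le; apply/andP; split.
  by rewrite le_measure ?inE//; exact: up_closed_measurable.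
apply: (@le_trans _ _ (eta a (fiber Ao i x))).
  by rewrite le_measure ?inE//; exact: up_closed_measurable.
have mfI := up_closed_measurable uI; have mfO := up_closed_measurable uO.
have IO := subset_trans IA AO.
rewrite -(setDKU IO) measureU//; [|exact: measurableD|by rewrite setDKI].
(* The fiber of a difference is the difference of the fibers by conversion. *)
by rewrite [X in (X + _)%E](gx : eta a (fiber Ao i x `\` fiber Ai i x) = 0%E) add0e.
Qed.

Lemma completed_power_derive a :
  (fine (completed_power (eta (a + h)) n A) - fine (completed_power (eta a) n A)) / h
    @[h --> 0^'] --> fine (\sum_(i < n) geometric_influence (eta a) A i)%E.
Proof.
rewrite completed_power_hull; under eq_fun do rewrite completed_power_hull.
under eq_bigr do rewrite geometric_influence_hull.
apply/cvgr_dnbhsP => h [h0 hcvg].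
by have [_] := borel_power_probability nuf cf fM mI iI; apply.
Qed.

(** Lets [fine] be removed from the limit, so that the final equality holds between extended
    reals. *)
Lemma geometric_influence_fin_num a :
  (\sum_(i < n) geometric_influence (eta a) A i)%E \is a fin_num.
Proof.
under eq_bigr do rewrite geometric_influence_hull.
have /andP[s0 sM] := influence_sum_bounds nuf cf fM a mI iI.
by rewrite ge0_fin_numE// (le_lt_trans sM)// ltry.
Qed.

End monotone_sets.

Unset Implicit Arguments.

Theorem proposition1p6 (R : realType) (nu : probability R R) (lambda : R -> R)
    (kL kR : \bar R) (n : nat) (A : set (n.-tuple R)) :
  has_density nu lambda ->
  continuous lambda ->
  (exists M : R, forall x, `|lambda x| <= M) ->
  (kL < kR)%E ->
  interior (measure_support nu) = [set z : R | (kL < z%:E < kR)%E] ->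
  (forall z : R, (kL < z%:E < kR)%E -> 0 < lambda z) ->
  monotone_increasing A ->
  let F := fun a : R => fine (completed_power (translate nu a) n A) in
  forall alpha : R,
    derivable F alpha 1 /\
    ((derive1 F alpha)%:E =
     \sum_(i < n) geometric_influence (translate nu alpha) A i)%E.
Proof.
move=> nuf cf [M fM] _ _ _ iA F a.
have D := completed_power_derive nuf cf fM iA (a := a).
(* This is the quotient of [derive1]; the one in [derivable] differs from it only by writing the
   step as [h *: 1]. *)
have D1 : h^-1 *: (F (h + a) - F a) @[h --> 0^'] -->
    fine (\sum_(i < n) geometric_influence (translate nu a) A i)%E.
  rewrite [X in X @ _](_ : _ = fun h => (F (a + h) - F a) / h); first exact: D.
  by apply/funext => h; rewrite [LHS]mulrC (addrC h).
split.
  apply/cvg_ex; eexists.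
  rewrite [X in X @ _](_ : _ = fun h => h^-1 *: (F (h + a) - F a)); first exact: D1.
  by apply/funext => h; rewrite /= /shift /= [h *: 1]mulr1.
rewrite /derive1 (cvg_lim _ D1)// fineK//.
exact: (geometric_influence_fin_num nuf cf fM iA).
Qed.
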